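(* Let $I$ be an open interval, let $\varepsilon,\widetilde\varepsilon\in\{1,-1\}$, and let $\pi:(M,g_M)\to(I,\widetilde\varepsilon\,ds^2)$ be a semi-Riemannian submersion with constant mean curvature fibers, with function $h:I\to\mathbb{R}$ representing the mean curvature of the fibers. Let $u\in C^2(M)$ be constant along the fibers of $\pi$, let $\widetilde F:M\to M\times\mathbb{R}$, $\widetilde F(x)=(x,u(x))$, be its graph map into $(M\times\mathbb{R},g_M+\varepsilon\,dt^2)$, assumed to be a semi-Riemannian hypersurface, and let $f:I\to\mathbb{R}$ be the map such that $u=f\circ\pi$. Then $\widetilde F$ is a translating soliton if and only if $f$ is a solution on $I$ to $$f''(s)=\big(\widetilde\varepsilon+\varepsilon f'(s)^2\big)\big(1-f'(s)h(s)\big).$$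
   Context: A semi-Riemannian submersion onto $(I,\widetilde\varepsilon\,ds^2)$ is a smooth surjective submersion with nondegenerate fibers such that $d\pi$ is a linear isometry from the orthogonal complement of $\ker d\pi$ onto the tangent space of $I$; regarding $\pi$ as a real function, this gives $g_M(\nabla\pi,\nabla\pi)=\widetilde\varepsilon$. The fibers are hypersurfaces; their mean curvature is taken with respect to the unit normal $\nabla\pi$, with the convention that the mean curvature is $\sum_i\varepsilon_i\,g_M(\nabla_{e_i}\nabla\pi,e_i)$ for an orthonormal frame $(e_i)$ of the fiber with $g_M(e_i,e_i)=\varepsilon_i$. That $h$ represents the mean curvature of the fibers means that this quantity is constant on each $\pi^{-1}(s)$, equal to $h(s)$; equivalently $\mathrm{div}(\nabla\pi)=h\circ\pi$. A graph map is a semi-Riemannian hypersurface if its induced metric is nondegenerate. It is a translating soliton if its mean curvature vector $\vec H$ (unnormalized trace of the second fundamental form) satisfies $\vec H=\partial_t^\perp$, where $\partial_t^\perp$ is the normal component of $\partial_t$. *)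

(* Defs.v *)
From HB Require Import structures.
From mathcomp Require Import all_boot all_order all_algebra.
From mathcomp Require Import all_classical all_reals all_analysis.

Set Implicit Arguments.
Unset Strict Implicit.
Unset Printing Implicit Defensive.

Import Order.TTheory GRing.Theory Num.Theory.
Import numFieldNormedType.Exports.

Local Open Scope classical_set_scope.
Local Open Scope ring_scope.

(* C^k maps on an open subset U of a finite-dimensional space: f is C^(k+1)
   when it is Frechet differentiable on U with directional derivatives of
   class C^k. *)
Fixpoint Ck (R : realType) (V W : normedModType R) (k : nat) (U : set V)
    (f : V -> W) : Prop :=
  match k with
  | 0%N => forall x, U x -> {for x, continuous f}
  | k'.+1 => (forall x, U x -> differentiable f x) /\
             (forall v, Ck k' U ('D_v f))
  end.

Definition Csmooth (R : realType) (V W : normedModType R) (U : set V)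
  (f : V -> W) : Prop := forall k, Ck k U f.

(* Points are row vectors in charts.  [chart_at p] is a distinguished chart
   around p: the tangent space at p is 'rV[R]_n, a tangent vector being given
   by its components in [chart_at p]. *)
Record charted (R : realType) (n : nat) := Charted {
  carrier :> topologicalType ;
  atlas : Type ;
  chart_at : carrier -> atlas ;
  cdom : atlas -> set carrier ;
  coord : atlas -> carrier -> 'rV[R]_n ;
  param : atlas -> 'rV[R]_n -> carrier
}.

Section Manifold.
Context {R : realType} {n : nat}.
Variable M : charted R n.

Definition cim (c : atlas M) : set 'rV[R]_n := coord c @` cdom c.

Definition transition (c d : atlas M) : 'rV[R]_n -> 'rV[R]_n :=
  coord d \o param c.

Definition overlap (c d : atlas M) : set 'rV[R]_n :=
  coord c @` (cdom c `&` cdom d).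

Record smooth_manifold : Prop := SmoothManifold {
  sm_hausdorff : hausdorff_space M ;
  sm_second_countable : @second_countable M ;
  sm_open_dom : forall c : atlas M, open (cdom c) ;
  sm_open_im : forall c : atlas M, open (cim c) ;
  sm_coordK : forall (c : atlas M) p, cdom c p -> param c (coord c p) = p ;
  sm_coord_cont : forall (c : atlas M) p, cdom c p ->
    {for p, continuous (coord c)} ;
  sm_param_cont : forall (c : atlas M) x, cim c x ->
    {for x, continuous (param c)} ;
  sm_chart_at : forall p : M, cdom (chart_at p) p ;
  sm_transition : forall c d : atlas M,
    Csmooth (overlap c d) (transition c d)
}.

Definition Ck_fun (k : nat) (u : M -> R) : Prop :=
  forall c : atlas M, Ck k (cim c) (u \o param c).

Definition smooth_fun (u : M -> R) : Prop := forall k, Ck_fun k u.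

(* Coordinates of p, and u read, in the distinguished chart at p. *)
Definition pt (p : M) : 'rV[R]_n := coord (chart_at p) p.

Definition local_fun (u : M -> R) (p : M) : 'rV[R]_n -> R :=
  u \o param (chart_at p).

Definition dfun (u : M -> R) (p : M) (v : 'rV[R]_n) : R :=
  'd (local_fun u p) (pt p) v.

End Manifold.

Arguments pt {R n M} p.

Section BilinearForms.
Context {R : realType} {n : nat}.
Implicit Types A : 'M[R]_n.

Definition ip A (v w : 'rV[R]_n) : R := (v *m A *m w^T) 0 0.

Definition neg_definite_on A (W : 'M[R]_n) : Prop :=
  forall v : 'rV[R]_n, (v <= W)%MS -> v != 0 -> ip A v v < 0.

Definition has_index A (nu : nat) : Prop :=
  (exists W : 'M[R]_n, \rank W = nu /\ neg_definite_on A W) /\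
  (forall W : 'M[R]_n, neg_definite_on A W -> (\rank W <= nu)%N).

End BilinearForms.

(* [metric g c x] is the Gram matrix of the coordinate frame of the chart c at
   the point of coordinates x. *)
Record semiRiem (R : realType) (n : nat) := SemiRiem {
  space :> charted R n ;
  metric : atlas space -> 'rV[R]_n -> 'M[R]_n
}.

Section SemiRiemannian.
Context {R : realType} {n : nat}.
Variable M : semiRiem R n.

(* [jacobian f x] is the matrix of the differential acting on row vectors,
   hence this form of the transformation law. *)
Record semi_riemannian_manifold : Prop := SemiRiemannianManifold {
  sr_smooth_manifold : smooth_manifold M ;
  sr_smooth : forall c : atlas M, Csmooth (cim c) (metric c) ;
  sr_sym : forall (c : atlas M) x, cim c x -> (metric c x)^T = metric c x ;
  sr_nondeg : forall (c : atlas M) x, cim c x -> metric c x \in unitmx ;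
  sr_index : exists nu, forall (c : atlas M) x, cim c x ->
    has_index (metric c x) nu ;
  sr_transition : forall (c d : atlas M) x, overlap c d x ->
    let J := jacobian (transition c d) x in
    metric c x = J *m metric d (transition c d x) *m J^T
}.

Definition local_metric (p : M) : 'rV[R]_n -> 'M[R]_n := metric (chart_at p).

Definition inner (p : M) (v w : 'rV[R]_n) : R := ip (local_metric p (pt p)) v w.

End SemiRiemannian.

Section Local.
Context {R : realType}.

Definition basis_vec {n : nat} (i : 'I_n) : 'rV[R]_n := delta_mx 0 i.

Definition christoffel {n : nat} (G : 'rV[R]_n -> 'M[R]_n) (x : 'rV[R]_n)
    (i j k : 'I_n) : R :=
  2^-1 * \sum_l (invmx (G x)) k l *
    ('D_(basis_vec i) (fun y => G y j l) x
     + 'D_(basis_vec j) (fun y => G y i l) x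
     - 'D_(basis_vec l) (fun y => G y i j) x).

(* Levi-Civita covariant derivative, in the direction v at x, of a vector field
   Y along the map F, G being the metric of the target of F.  For F = id this
   is the usual covariant derivative of a vector field. *)
Definition covd {n m : nat} (G : 'rV[R]_m -> 'M[R]_m)
    (F : 'rV[R]_n -> 'rV[R]_m) (Y : 'rV[R]_n -> 'rV[R]_m)
    (v x : 'rV[R]_n) : 'rV[R]_m :=
  'D_v Y x +
  \row_k \sum_i \sum_j
     christoffel G (F x) i j k * ('D_v F x) 0 i * (Y x) 0 j.

(* Index raising on row vectors: ip (G x) (gradient G phi x) w = d phi w. *)
Definition gradient {n : nat} (G : 'rV[R]_n -> 'M[R]_n) (phi : 'rV[R]_n -> R)
    (x : 'rV[R]_n) : 'rV[R]_n :=
  (\row_i 'D_(basis_vec i) phi x) *m invmx (G x).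

Section Immersion.
Context {n m : nat}.
Variables (G : 'rV[R]_m -> 'M[R]_m) (F : 'rV[R]_n -> 'rV[R]_m).

Definition induced (x : 'rV[R]_n) : 'M[R]_n :=
  jacobian F x *m G (F x) *m (jacobian F x)^T.

(* The tangential component of Z is
   sum_ij (induced^-1)_ij G(Z, dF e_i) dF e_j. *)
Definition normal_part (x : 'rV[R]_n) (Z : 'rV[R]_m) : 'rV[R]_m :=
  Z - Z *m G (F x) *m (jacobian F x)^T *m invmx (induced x) *m jacobian F x.

Definition second_form (v w x : 'rV[R]_n) : 'rV[R]_m :=
  normal_part x (covd G F ('D_w F) v x).

Definition mean_curvature (x : 'rV[R]_n) : 'rV[R]_m :=
  \sum_i \sum_j
    (invmx (induced x)) i j *: second_form (basis_vec i) (basis_vec j) x.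

End Immersion.
End Local.

Section Submersion.
Context {R : realType} {n : nat}.
Variables (M : semiRiem R n) (I : set R) (teps : R) (pi : M -> R).

Definition vertical (p : M) (v : 'rV[R]_n) : Prop := dfun pi p v = 0.

Definition horizontal (p : M) (v : 'rV[R]_n) : Prop :=
  forall w, vertical p w -> inner p v w = 0.

(* The target is (I, teps ds^2), whose tangent spaces are R with the form
   (a, b) |-> teps * a * b. *)
Record semi_riemannian_submersion : Prop := SemiRiemannianSubmersion {
  sub_smooth : smooth_fun pi ;
  sub_onto : range pi = I ;
  sub_submersion : forall p (a : R), exists v, dfun pi p v = a ;
  sub_fiber_nondeg : forall p v, vertical p v ->
    (forall w, vertical p w -> inner p v w = 0) -> v = 0 ;
  sub_isometry : forall p v w, horizontal p v -> horizontal p w ->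
    teps * dfun pi p v * dfun pi p w = inner p v w ;
  sub_isometry_onto : forall p (a : R),
    exists2 v, horizontal p v & dfun pi p v = a
}.

(* The rows of E are an orthonormal basis of the tangent space of the fiber
   through p, of dimension n - 1, and s lists the signs. *)
Definition fiber_frame (p : M) (E : 'M[R]_(n.-1, n)) (s : 'rV[R]_n.-1) : Prop :=
  [/\ forall i, s 0 i = 1 \/ s 0 i = -1,
      forall i, vertical p (row i E) &
      E *m local_metric p (pt p) *m E^T = diag_mx s].

Definition nabla_grad (p : M) (v : 'rV[R]_n) : 'rV[R]_n :=
  covd (local_metric p) id (gradient (local_metric p) (local_fun pi p)) v (pt p).

(* The sum does not depend on the orthonormal frame, so any one will do.  For
   n = 1 the fibers are discrete and the sum is empty. *)
Definition fiber_mean_curvature (p : M) (H : R) : Prop :=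
  exists E s, fiber_frame p E s /\
    H = \sum_i s 0 i * inner p (nabla_grad p (row i E)) (row i E).

Definition represents_fiber_mean_curvature (h : R -> R) : Prop :=
  forall p, fiber_mean_curvature p (h (pi p)).

Definition constant_along_fibers (u : M -> R) : Prop :=
  forall p q, pi p = pi q -> u p = u q.

End Submersion.

(* M x R with the product charts (x, t); [prod_line M eps] carries the metric
   g_M + eps dt^2.  The distinguished chart at (p, t) is the product of
   [chart_at p] with R. *)
Definition prod_charted {R : realType} {n : nat} (M : charted R n) :
    charted R (n + 1) :=
  @Charted R (n + 1) (M * R)%type (atlas M)
    (fun q => chart_at q.1)
    (fun c => [set q | cdom c q.1])
    (fun c q => row_mx (coord c q.1) (const_mx q.2))
    (fun c y => (param c (lsubmx y), rsubmx y 0 0)).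

Definition prod_line {R : realType} {n : nat} (M : semiRiem R n) (eps : R) :
    semiRiem R (n + 1) :=
  @SemiRiem R (n + 1) (prod_charted M)
    (fun (c : atlas M) y => block_mx (metric c (lsubmx y)) 0 0 eps%:M).

Section Immersions.
Context {R : realType} {n m : nat}.
Variables (M : charted R n) (N : semiRiem R m) (F : M -> N).

Definition local_map (p : M) : 'rV[R]_n -> 'rV[R]_m :=
  coord (chart_at (F p)) \o F \o param (chart_at p).

Definition nondegenerate_immersion : Prop :=
  forall p, induced (local_metric (F p)) (local_map p) (pt p) \in unitmx.

Definition mean_curvature_vector (p : M) : 'rV[R]_m :=
  mean_curvature (local_metric (F p)) (local_map p) (pt p).

Definition normal_component (p : M) (Z : 'rV[R]_m) : 'rV[R]_m :=
  normal_part (local_metric (F p)) (local_map p) (pt p) Z.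

End Immersions.

Section Graphs.
Context {R : realType} {n : nat}.
Variables (M : semiRiem R n) (eps : R).

Definition graph_map (u : M -> R) : M -> prod_line M eps := fun p => (p, u p).

Definition semi_riemannian_hypersurface (F : M -> prod_line M eps) : Prop :=
  nondegenerate_immersion F.

Definition partial_t : 'rV[R]_(n + 1) := row_mx 0 1.

Definition translating_soliton (F : M -> prod_line M eps) : Prop :=
  forall p, mean_curvature_vector F p = normal_component F p partial_t.

End Graphs.

(* I is meant to be open, so only the values of f and h on I matter. *)
Definition soliton_ode {R : realType} (I : set R) (eps teps : R) (h f : R -> R)
    : Prop :=
  forall s, I s ->
    [/\ derivable f s 1, derivable (derive1 f) s 1 &
        derive1 (derive1 f) s =
          (teps + eps * derive1 f s ^+ 2) * (1 - derive1 f s * h s)].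

(* Main.v *)
Require Import Defs.
From mathcomp Require Import all_boot all_order all_algebra.
From mathcomp Require Import all_classical all_reals all_analysis.
From mathcomp Require Import ring.
Import Order.TTheory GRing.Theory Num.Theory.
Import numFieldNormedType.Exports.
Local Open Scope classical_set_scope.
Local Open Scope ring_scope.

(** Write [N] for the gradient of [pi] and [g] for the metric of [M]. In the
    product metric, the tangent space of the graph of [u] consists of the
    vectors [(z, du z)] and the induced metric is [A = g + eps du^2]. The mean
    curvature vector is the normal part of the [A]-trace of second derivatives
    of the graph map, and two vectors have the same normal part exactly when
    they differ by a tangent vector; so the graph is a translating soliton if
    and only if [tr (A^-1 Hess u) = 1] everywhere ([graph_soliton]).

    For [u = f o pi] one has [du = f' dpi] and [Hess u = f'' dpi^2 + f' Hess pi]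
    ([hessian_factor]), so two facts about [pi] are needed. Being an isometry on
    horizontal vectors, [pi] satisfies [g (N, N) = teps] ([inner_grad_grad],
    [chart_gradient_norm]); differentiating this identity gives [Hess pi (v, N)
    = g (nabla_v N, N) = 0] ([ip_hessian_gradient], [hessian_grad]).
    Consequently the trace of [Hess pi] over an orthonormal frame of the fiber,
    which is the mean curvature [h], is its full [g]-trace ([trace_hessian]),
    and it is also its [A]-trace, since [A] differs from [g] only along [N]. The
    Sherman-Morrison formula ([rank_one_update_trace]) then turns the soliton
    equation into [f'' teps / (1 + eps teps f'^2) + f' h = 1]. Its denominator
    is nonzero because [A] is nondegenerate, and clearing it gives the
    differential equation ([soliton_scalar]).

    That [f] is twice differentiable is part of the conclusion. Along a line of
    a chart transverse to the fibers, [pi] is a local change of parameter of the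
    real line, and [f] is [u] along the line composed with its inverse
    ([factor_twice_derivable]). *)

(** * Inverse metrics in orthonormal frames and rank one updates *)

Section LinearAlgebra.
Context {K : fieldType}.

(** In an orthonormal frame the Gram matrix is a diagonal of signs, so the
    inverse metric is the signed sum of the squares of the frame vectors.  The
    frame is made of a transverse vector [N] and of the rows of [E]; the index
    [1 + n] matches this splitting. *)
Lemma orthonormal_frame_invmx {n : nat} (G : 'M[K]_(1 + n))
    (E : 'M[K]_(n, 1 + n)) (N : 'rV[K]_(1 + n)) (s : 'rV[K]_n) (e : K) :
  (forall i, s 0 i * s 0 i = 1) -> e * e = 1 ->
  E *m G *m E^T = diag_mx s -> E *m G *m N^T = 0 -> N *m G *m E^T = 0 ->
  N *m G *m N^T = e%:M ->
  invmx G = E^T *m diag_mx s *m E + e *: (N^T *m N).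
Proof.
move=> hs he hE hEN hNE hN.
pose K0 := E^T *m diag_mx s *m E + e *: (N^T *m N).
pose B : 'M[K]_(1 + n) := col_mx N E.
have ss : diag_mx s *m diag_mx s = 1%:M.
  by rewrite mulmx_diag -diag_const_mx; congr diag_mx; apply/rowP => i;
     rewrite !mxE hs.
(* [G K0] fixes every frame vector, and the frame is a basis. *)
have BGK : B *m G *m K0 = B.
  rewrite /B !mul_col_mx.
  rewrite /K0 !mulmxDr -!scalemxAr !mulmxA hNE hN hE hEN !mul0mx scaler0 addr0.
  rewrite add0r ss mul1mx mul_scalar_mx scalerA he scale1r.
  by [].
have BGB : B *m G *m B^T = block_mx e%:M 0 0 (diag_mx s).
  rewrite /B mul_col_mx tr_col_mx mul_col_row.
  by rewrite hNE hN hE hEN.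
have : \det (B *m G *m B^T) != 0.
  rewrite BGB det_ublock det_scalar1 det_diag mulf_neq0 //.
    by apply: contra_eq_neq he => ->; rewrite mul0r eq_sym oner_eq0.
  by apply/prodf_neq0 => i _; apply: contra_eq_neq (hs i) => ->;
     rewrite mul0r eq_sym oner_eq0.
rewrite !det_mulmx !mulf_eq0 !negb_or -andbA => /and3P[dB dG _].
have uB : B \in unitmx by rewrite unitmxE unitfE.
have uG : G \in unitmx by rewrite unitmxE unitfE.
have GK : G *m K0 = 1%:M.
  by rewrite -(mulKmx uB (G *m K0)) [B *m (_ *m _)]mulmxA BGK mulVmx.
by rewrite -/K0 -[RHS](mulKmx uG) GK mulmx1.
Qed.

(** The metric induced on a graph is the metric of the base plus a multiple of
    the square of a covector [a]; its inverse is given by the Sherman-Morrison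
    formula, [e] being the square length of [a] and [N] its dual vector. *)
Section RankOneUpdate.
Context {n : nat}.
Variables (G : 'M[K]_n) (a : 'rV[K]_n) (e k : K).
Hypotheses (G_unit : G \in unitmx) (G_sym : G^T = G) (e_sqr : e * e = 1).
Hypothesis a_norm : a *m invmx G *m a^T = e%:M.
Let N := a *m invmx G.
Let A := G + k *: (a^T *m a).
Hypothesis A_unit : A \in unitmx.

Let N_A : N *m A = (1 + k * e) *: a.
Proof.
rewrite /A mulmxDr mulmxKV // -scalemxAr mulmxA a_norm mul_scalar_mx scalerA.
by rewrite -{1}[a]scale1r -scalerDl.
Qed.

(** Otherwise the nonzero vector [N] would be in the kernel of [A]. *)
Lemma rank_one_update_neq0 : 1 + k * e != 0.
Proof.
apply/eqP => ke0.
have N0 : N = 0 by rewrite -(mulmxK A_unit N) N_A ke0 scale0r mul0mx.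
have /matrixP/(_ 0 0) := a_norm.
rewrite -/N N0 mul0mx !mxE eqxx mulr1n => e0; move: e_sqr; rewrite -e0 mul0r.
by move/eqP; rewrite eq_sym oner_eq0.
Qed.

Lemma rank_one_update_invmx :
  invmx A = invmx G - (k / (1 + k * e)) *: (N^T *m N).
Proof.
set c := k / _; have ke0 := rank_one_update_neq0.
suff : (invmx G - c *: (N^T *m N)) *m A = 1%:M.
  by move=> h; rewrite -[LHS]mul1mx -h mulmxK.
rewrite mulmxBl -scalemxAl -mulmxA N_A /A mulmxDr mulVmx //.
have -> : N^T = invmx G *m a^T by rewrite /N trmx_mul trmx_inv G_sym.
rewrite -!scalemxAr scalerA /c divfK // mulmxA addrK //.
Qed.

(** [H] stands for the Hessian of a function with differential [a].  The
    correction term of the inverse only sees [N H N^T], so when [H] vanishes on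
    the gradient, as for a gradient of constant length, the two traces of [H]
    coincide. *)
Lemma rank_one_update_trace (H : 'M[K]_n) (f1 f2 m : K) :
  N *m H *m N^T = 0 -> \tr (invmx G *m H^T) = m ->
  \tr (invmx A *m (f2 *: (a^T *m a) + f1 *: H)^T) =
    f2 * (e / (1 + k * e)) + f1 * m.
Proof.
move=> NHN trH; have ke0 := rank_one_update_neq0.
rewrite linearD /= !linearZ /= trmx_mul trmxK mulmxDr linearD /= -!scalemxAr.
rewrite !linearZ /=; congr (_ * _ + _ * _).
  rewrite mulmxA mxtrace_mulC mulmxA.
  have -> : a *m invmx A = (1 + k * e)^-1 *: N.
    by rewrite -(mulmxK A_unit N) N_A -scalemxAl scalerA mulVf // scale1r.
  by rewrite -scalemxAl a_norm scale_scalar_mx mulrC mxtrace_scalar.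
rewrite rank_one_update_invmx mulmxBl linearB /= trH -scalemxAl linearZ /=.
rewrite -mulmxA mxtrace_mulC -mulmxA.
have -> : N *m (H^T *m N^T) = 0.
  by apply: trmx_inj; rewrite trmx0 trmx_mul [(H^T *m _)^T]trmx_mul !trmxK NHN.
by rewrite linear0 mulr0 subr0.
Qed.

End RankOneUpdate.
End LinearAlgebra.

(** * Differentiation of matrix-valued maps *)

Section Calculus.
Context {R : realType} {V : normedModType R}.
Implicit Types x v : V.

Lemma derivable_bigsum {J : Type} (r : seq J) (P : pred J) (F : J -> V -> R)
    x v :
  (forall j, P j -> derivable (F j) x v) ->
  derivable (fun y => \sum_(j <- r | P j) F j y) x v.
Proof.
move=> dF; rewrite -fct_sumE.
elim/big_rec : _ => [|j f Pj df]; first exact: derivable_cst.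
exact: derivableD (dF _ Pj) df.
Qed.

Lemma derive_bigsum {J : Type} (r : seq J) (P : pred J) (F : J -> V -> R)
    x v :
  (forall j, P j -> derivable (F j) x v) ->
  'D_v (fun y => \sum_(j <- r | P j) F j y) x =
  \sum_(j <- r | P j) 'D_v (F j) x.
Proof.
move=> dF; rewrite -fct_sumE.
apply/(@derive_val _ _ _ x v); elim/big_rec2 : _ => [|j f g Pj df].
  exact: is_derive_cst.
by apply: is_deriveD; exact/derivableP/dF.
Qed.

Lemma derivable_bigprod {J : Type} (r : seq J) (P : pred J) (F : J -> V -> R)
    x v :
  (forall j, P j -> derivable (F j) x v) ->
  derivable (fun y => \prod_(j <- r | P j) F j y) x v.
Proof.
move=> dF; elim: r => [|j r IH].
  by under eq_fun do rewrite big_nil; exact: derivable_cst.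
under eq_fun do rewrite big_cons; case: ifP => [Pj|_]; last exact: IH.
exact: derivableM (dF _ Pj) IH.
Qed.

Section MatrixValued.
Context {m n p : nat}.
Variables (A : V -> 'M[R]_(m, n)) (B : V -> 'M[R]_(n, p)) (x v : V).
Hypotheses (dA : derivable A x v) (dB : derivable B x v).

Lemma derivable_mulmx : derivable (fun y => A y *m B y) x v.
Proof.
apply/derivable_mxP => i j; under eq_fun do rewrite mxE.
apply: derivable_bigsum => k _.
by apply: derivableM; [exact: (derivable_mxP _ _ _).1 dA _ _|
                       exact: (derivable_mxP _ _ _).1 dB _ _].
Qed.

Lemma derive_mulmx :
  'D_v (fun y => A y *m B y) x = 'D_v A x *m B x + A x *m 'D_v B x.
Proof.
have dAij i j := (derivable_mxP _ _ _).1 dA i j.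
have dBij i j := (derivable_mxP _ _ _).1 dB i j.
rewrite (derive_mx derivable_mulmx) !(derive_mx dA, derive_mx dB).
apply/matrixP => i j; rewrite !mxE.
under eq_fun do rewrite mxE.
rewrite derive_bigsum; last by move=> k _; exact: derivableM.
rewrite -big_split; apply: eq_bigr => k _ /=.
rewrite (deriveM (dAij i k) (dBij k j)) !mxE /GRing.scale /=.
by rewrite addrC; congr (_ + _); exact: mulrC.
Qed.

End MatrixValued.

Lemma derive_trmx {m n : nat} (A : V -> 'M[R]_(m, n)) x v :
  derivable A x v -> 'D_v (fun y => (A y)^T) x = ('D_v A x)^T.
Proof.
move=> dA; rewrite !derive_mx //; last first.
  apply/derivable_mxP => i j; under eq_fun do rewrite mxE.
  exact: (derivable_mxP _ _ _).1 dA _ _.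
by apply/matrixP => i j; rewrite !mxE; under eq_fun do rewrite mxE.
Qed.

Lemma derivable_det {n : nat} (A : V -> 'M[R]_n) x v :
  derivable A x v -> derivable (fun y => \det (A y)) x v.
Proof.
move=> dA; apply: derivable_bigsum => s _; apply: derivableM.
  exact: derivable_cst.
by apply: derivable_bigprod => i _; exact: (derivable_mxP _ _ _).1 dA _ _.
Qed.

Lemma derivable_invmx {n : nat} (A : V -> 'M[R]_n) x v :
  derivable A x v -> (\forall y \near x, A y \in unitmx) ->
  derivable (fun y => invmx (A y)) x v.
Proof.
move=> dA uA.
apply: (@near_eq_derivable _ _ _ (fun y => (\det (A y))^-1 *: \adj (A y))).
  near=> y; have uy : A y \in unitmx by near: y.
  by rewrite /invmx uy.
apply/derivable_mxP => i j; under eq_fun do rewrite !mxE.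
apply: derivableM.
  apply: derivableV; last exact: derivable_det.
  by have := nbhs_singleton uA; rewrite unitmxE unitfE.
apply: derivableM; first exact: derivable_cst.
apply: derivable_det; apply/derivable_mxP => k l; under eq_fun do rewrite !mxE.
exact: (derivable_mxP _ _ _).1 dA _ _.
Unshelve. all: by end_near. Qed.

End Calculus.

Section Differentiable.
Context {R : realType} {V : normedModType R}.

(** Unlike directional derivatives, the Frechet differential is specified by a
    little-o at the point, which only depends on the germ. *)
Lemma near_eq_is_diff {W : normedModType R} (f g : V -> W) x :
  (\forall y \near x, f y = g y) -> differentiable f x -> is_diff x g ('d f x).
Proof.
move=> fg df.
have [cdf fE] := (diff_locallyP _ _).1 df.
have gE : g \o shift x = cst (g x) + 'd f x +o_ (0 : V) id.
  rewrite -(nbhs_singleton fg).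
  apply/eqaddoP => _/posnumP[e].
  have /eqaddoP/(_ e%:num [gt0 of e%:num]) := fE.
  have : \forall y \near (0 : V), f (y + x) = g (y + x).
    have := fg; rewrite (near_shift 0 x) /=.
    by apply: filterS => y; rewrite subr0.
  by apply: filterS2 => y /= Ey; rewrite /= !fctE /= Ey.
have dg := diff_unique cdf gE.
have dG : differentiable g x by apply/diff_locallyP; rewrite dg.
exact: DiffDef dG dg.
Qed.

Lemma differentiable_mx {m n : nat} (A : V -> 'M[R]_(m, n)) x :
  (forall i j, differentiable (fun y => A y i j) x) -> differentiable A x.
Proof.
move=> dA.
have -> : A = \sum_i \sum_j (fun y => A y i j *: delta_mx i j).
  apply/funext => y; rewrite fct_sumE [LHS]matrix_sum_delta.
  by apply: eq_bigr => i _; rewrite fct_sumE.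
apply: differentiable_sum => i; apply: differentiable_sum => j.
exact: differentiableZl.
Qed.

Lemma differentiable_entry {m n : nat} (A : V -> 'M[R]_(m, n)) x i j :
  differentiable A x -> differentiable (fun y => A y i j) x.
Proof.
by move=> dA; exact: differentiable_comp dA (differentiable_coord _ _ _).
Qed.

End Differentiable.

Section Partials.
Context {R : realType} {n : nat}.
Implicit Types (phi : 'rV[R]_n -> R) (x v : 'rV[R]_n).

Definition partials phi x : 'rV[R]_n := \row_i 'D_(basis_vec i) phi x.

Lemma basis_expansion v : v = \sum_i v 0 i *: basis_vec i.
Proof. by rewrite [LHS]row_sum_delta. Qed.

Lemma derive_basis {W : normedModType R} (f : 'rV[R]_n -> W) x v :
  differentiable f x -> 'D_v f x = \sum_i v 0 i *: 'D_(basis_vec i) f x.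
Proof.
move=> df; rewrite deriveE // {1}(basis_expansion v) linear_sum.
by apply: eq_bigr => i _; rewrite linearZ deriveE.
Qed.

Lemma derive_partials phi x v :
  differentiable phi x -> 'D_v phi x = \sum_i v 0 i * partials phi x 0 i.
Proof.
by move=> dphi; rewrite derive_basis //; apply: eq_bigr => i _; rewrite mxE.
Qed.

End Partials.

(** * Hessian and gradient in a chart *)

Section InnerProduct.
Context {R : realType} {n : nat}.
Implicit Types (A : 'M[R]_n) (v w : 'rV[R]_n).

Lemma mxE_ip A v w : (v *m A *m w^T) 0 0 = ip A v w.
Proof. by []. Qed.

Lemma ipE A v w : ip A v w = \sum_i \sum_j v 0 i * A i j * w 0 j.
Proof.
rewrite /ip mxE exchange_big /=; apply: eq_bigr => j _.
by rewrite !mxE mulr_suml.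
Qed.

Lemma ip_mx A v w : v *m A *m w^T = (ip A v w)%:M.
Proof. exact: mx11_scalar. Qed.

Lemma ip_sym A v w : A^T = A -> ip A v w = ip A w v.
Proof.
move=> symA; rewrite /ip.
have -> : w *m A *m v^T = (v *m A *m w^T)^T.
  by rewrite !trmx_mul trmxK symA mulmxA.
by rewrite [RHS]mxE.
Qed.

Lemma ipDl A v v' w : ip A (v + v') w = ip A v w + ip A v' w.
Proof. by rewrite /ip !mulmxDl mxE. Qed.

End InnerProduct.

Section Local.
Context {R : realType} {n : nat}.

Definition twice_differentiable (phi : 'rV[R]_n -> R) x :=
  (\forall y \near x, differentiable phi y) /\
  forall w, differentiable ('D_w phi) x.

(** The zeroth order term of [covd], as a bilinear map. *)
Definition chr (G : 'rV[R]_n -> 'M[R]_n) (x v w : 'rV[R]_n) : 'rV[R]_n :=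
  \row_k \sum_i \sum_j christoffel G x i j k * v 0 i * w 0 j.

Definition hessian (G : 'rV[R]_n -> 'M[R]_n) (phi : 'rV[R]_n -> R) x :
    'M[R]_n :=
  \matrix_(i, j) ('D_(basis_vec i) ('D_(basis_vec j) phi) x
                  - \sum_k christoffel G x i j k * partials phi x 0 k).

Lemma derive_derive (phi : 'rV[R]_n -> R) x v w : twice_differentiable phi x ->
  'D_v ('D_w phi) x =
  \sum_i \sum_j v 0 i * w 0 j * 'D_(basis_vec i) ('D_(basis_vec j) phi) x.
Proof.
move=> [dphi d2phi]; rewrite derive_basis //; apply: eq_bigr => i _.
rewrite (@near_eq_derive _ _ _ _
  (fun y => \sum_j w 0 j * 'D_(basis_vec j) phi y)); last first.
  by apply: filterS dphi => y dy; rewrite derive_basis.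
have dj j : derivable (fun y => w 0 j * 'D_(basis_vec j) phi y) x (basis_vec i).
  by apply: derivableM; [exact: derivable_cst|exact: diff_derivable].
rewrite derive_bigsum // scaler_sumr; apply: eq_bigr => j _.
rewrite deriveMl; first by rewrite /GRing.scale /= mulrA.
exact: diff_derivable.
Qed.

Lemma ip_hessian G (phi : 'rV[R]_n -> R) x v w : twice_differentiable phi x ->
  ip (hessian G phi x) v w =
  'D_v ('D_w phi) x - (chr G x v w *m (partials phi x)^T) 0 0.
Proof.
move=> d2; rewrite derive_derive // ipE mxE.
under [X in _ - X]eq_bigr => k _.
  rewrite !mxE mulr_suml.
  under eq_bigr do rewrite mulr_suml.
  over.
rewrite [X in _ = _ - X]exchange_big /= -sumrB; apply: eq_bigr => i _.
rewrite [X in _ = _ - X]exchange_big /= -sumrB; apply: eq_bigr => j _.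
rewrite [hessian _ _ _ _ _]mxE mulrBr mulrBl [X in X - _]mulrAC.
apply: (congr1 (fun X => _ - X)).
rewrite mulr_sumr mulr_suml; apply: eq_bigr => k _; rewrite ?mxE.
ring.
Qed.

Section MetricAt.
Variables (G : 'rV[R]_n -> 'M[R]_n) (x : 'rV[R]_n).
Hypotheses (G_diff : differentiable G x)
  (G_unit : \forall y \near x, G y \in unitmx)
  (G_sym : \forall y \near x, (G y)^T = G y).

Let G_derivable v : derivable G x v. Proof. exact: diff_derivable. Qed.

Let dG_sym v : ('D_v G x)^T = 'D_v G x.
Proof. by rewrite -derive_trmx //; apply: near_eq_derive. Qed.

Let derive_metric v j l :
  'D_v G x j l = \sum_i v 0 i * 'D_(basis_vec i) (fun y => G y j l) x.
Proof.
rewrite derive_mx // mxE derive_basis //; exact: differentiable_entry.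
Qed.

(** Lowering the index of the Christoffel symbols cancels the inverse metric in
    their definition: this is the Koszul formula for constant vector fields. *)
Lemma ip_chr v w z : ip (G x) (chr G x v w) z =
  2^-1 * (ip ('D_v G x) w z + ip ('D_w G x) v z - ip ('D_z G x) v w).
Proof.
pose c i j l := 'D_(basis_vec i) (fun y => G y j l) x
  + 'D_(basis_vec j) (fun y => G y i l) x
  - 'D_(basis_vec l) (fun y => G y i j) x.
pose b := \row_l \sum_i \sum_j c i j l * v 0 i * w 0 j.
have -> : chr G x v w = 2^-1 *: (b *m (invmx (G x))^T).
  apply/rowP => k; rewrite !mxE mulr_sumr.
  under [RHS]eq_bigr => l _.
    rewrite !mxE mulr_suml mulr_sumr.
    under eq_bigr do rewrite mulr_suml mulr_sumr.
    over.
  rewrite [RHS]exchange_big /=; apply: eq_bigr => i _.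
  rewrite [RHS]exchange_big /=; apply: eq_bigr => j _.
  rewrite /christoffel mulr_sumr !mulr_suml; apply: eq_bigr => l _.
  rewrite -/(c i j l); ring.
rewrite -{1}mxE_ip -!scalemxAl mxE trmx_inv (nbhs_singleton G_sym).
rewrite mulmxKV; last exact: nbhs_singleton G_unit.
apply: (congr1 ( *%R _)).
(* Only the linear algebra matters from here: hide the derivatives of [G]. *)
have [dG dGE] : exists dG, forall v, 'D_v G x = dG v by eexists.
rewrite !dGE !ipE.
rewrite mxE.
have E1 : \sum_i \sum_j w 0 i * dG v i j * z 0 j =
    \sum_l \sum_i \sum_j
      'D_(basis_vec i) (fun y => G y j l) x * v 0 i * w 0 j * z 0 l.
  rewrite exchange_big /=; apply: eq_bigr => l _.
  rewrite exchange_big /=; apply: eq_bigr => j _.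
  rewrite -dGE derive_metric mulr_sumr mulr_suml; apply: eq_bigr => i _; ring.
have E2 : \sum_i \sum_j v 0 i * dG w i j * z 0 j =
    \sum_l \sum_i \sum_j
      'D_(basis_vec j) (fun y => G y i l) x * v 0 i * w 0 j * z 0 l.
  rewrite exchange_big /=; apply: eq_bigr => l _; apply: eq_bigr => i _.
  rewrite -dGE derive_metric mulr_sumr mulr_suml; apply: eq_bigr => j _; ring.
have E3 : \sum_i \sum_j v 0 i * dG z i j * w 0 j =
    \sum_l \sum_i \sum_j
      'D_(basis_vec l) (fun y => G y i j) x * v 0 i * w 0 j * z 0 l.
  rewrite [RHS]exchange_big /=; apply: eq_bigr => i _.
  rewrite [RHS]exchange_big /=; apply: eq_bigr => j _.
  rewrite -dGE derive_metric mulr_sumr mulr_suml; apply: eq_bigr => l _; ring.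
rewrite E1 E2 E3.
rewrite -big_split -sumrB.
apply: eq_bigr => l _.
rewrite !mxE mulr_suml -big_split -sumrB; apply: eq_bigr => i _.
rewrite mulr_suml -big_split -sumrB; apply: eq_bigr => j _ /=.
rewrite /c; ring.
Qed.

Section Gradient.
Variable phi : 'rV[R]_n -> R.
Hypothesis phi_diff : twice_differentiable phi x.
Let N := gradient G phi.

Lemma gradient_metric y : G y \in unitmx -> N y *m G y = partials phi y.
Proof. by move=> uG; rewrite /N /gradient mulmxKV. Qed.

Let partials_derivable v : derivable (partials phi) x v.
Proof.
apply/derivable_mxP => i j; under eq_fun do rewrite mxE.
by apply: diff_derivable; exact: phi_diff.2.
Qed.

Let N_derivable v : derivable N x v.
Proof. by apply: derivable_mulmx => //; exact: derivable_invmx. Qed.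

(* Differentiate [d phi = N G] along [v]. *)
Let derive_derive_gradient v w :
  'D_v ('D_w phi) x = ip (G x) ('D_v N x) w + ip ('D_v G x) (N x) w.
Proof.
have -> : 'D_v ('D_w phi) x = ('D_v (partials phi) x *m w^T) 0 0.
  rewrite (derive_mx (partials_derivable v)).
  rewrite (@near_eq_derive _ _ _ _
    (fun y => \sum_j w 0 j * partials phi y 0 j));
    last by apply: filterS phi_diff.1 => y dy; rewrite derive_partials.
  have dj j : derivable (fun y => partials phi y 0 j) x v.
    exact: (derivable_mxP _ _ _).1 (partials_derivable v) _ _.
  rewrite derive_bigsum; last first.
    by move=> j _; apply: derivableM => //; exact: derivable_cst.
  by rewrite mxE; apply: eq_bigr => j _; rewrite !mxE deriveMl // mulrC.
have -> : 'D_v (partials phi) x = 'D_v (fun y => N y *m G y) x.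
  apply: near_eq_derive; apply: filterS G_unit => y uy.
  by rewrite gradient_metric.
by rewrite derive_mulmx // mulmxDl mxE.
Qed.

(** The covariant differential of the gradient is dual to the Hessian: both
    sides expand by the product rule and the Koszul formula to the same
    first derivatives of [G]. *)
Lemma ip_covd_gradient v w :
  ip (G x) (covd G id N v x) w = ip (hessian G phi x) v w.
Proof.
rewrite ip_hessian // -gradient_metric ?(nbhs_singleton G_unit) //.
rewrite trmx_mul (nbhs_singleton G_sym) mulmxA mxE_ip.
rewrite derive_derive_gradient /covd derive_id -/(chr G x v (N x)) ipDl.
rewrite !ip_chr.
have [dG dGE] : exists dG, forall v, 'D_v G x = dG v by eexists.
have dGT u : (dG u)^T = dG u by rewrite -dGE; exact: dG_sym.
rewrite !dGE [ip (dG v) w _]ip_sym // [ip (dG w) v _]ip_sym //.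
set p := ip _ ('D_v N x) w.
move: p (ip (dG v) _ _) (ip (dG w) _ _) (ip (dG (N x)) _ _) => a b c d.
by field.
Qed.

(** By metric compatibility, [hess phi (v, N) = G (nabla_v N, N)] is half the
    derivative of [G (N, N)]; hence a gradient of constant length is in the
    kernel of the Hessian. *)
Lemma ip_hessian_gradient v :
  ip (hessian G phi x) v (N x) = 2^-1 * 'D_v (fun y => ip (G y) (N y) (N y)) x.
Proof.
rewrite -ip_covd_gradient /covd derive_id -/(chr G x v (N x)) ipDl ip_chr.
have dNG : derivable (fun y => N y *m G y) x v by exact: derivable_mulmx.
have dNT : derivable (fun y => (N y)^T) x v.
  apply/derivable_mxP => i j; under eq_fun do rewrite mxE.
  exact: (derivable_mxP _ _ _).1 (N_derivable v) _ _.
have dNGN : derivable (fun y => N y *m G y *m (N y)^T) x v.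
  exact: derivable_mulmx.
have -> : 'D_v (fun y => ip (G y) (N y) (N y)) x =
    'D_v (fun y => N y *m G y *m (N y)^T) x 0 0.
  by rewrite (derive_mx dNGN) mxE.
rewrite (derive_mulmx _ _ _ _ dNG dNT).
rewrite (derive_mulmx _ _ _ _ (N_derivable v) (G_derivable v)).
rewrite (derive_trmx _ _ _ (N_derivable v)) mulmxDl.
rewrite [X in _ = _ * X]mxE [X in _ = _ * (X + _)]mxE !mxE_ip.
rewrite [ip (G x) (N x) ('D_v N x)]ip_sym ?(nbhs_singleton G_sym) //.
have [dG dGE] : exists dG, forall v, 'D_v G x = dG v by eexists.
rewrite !dGE; set p := ip _ ('D_v N x) _.
by move: p (ip (dG v) _ _) (ip (dG (N x)) _ _) => a b c; field.
Qed.

End Gradient.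
End MetricAt.
End Local.

(** * Product metrics and graphs *)

Section NormalPart.
Context {R : realType} {n m : nat}.
Variables (G : 'rV[R]_m -> 'M[R]_m) (F : 'rV[R]_n -> 'rV[R]_m) (x : 'rV[R]_n).

Lemma normal_partB Z Z' :
  normal_part G F x (Z - Z') = normal_part G F x Z - normal_part G F x Z'.
Proof. by rewrite /normal_part !mulmxBl !opprD addrACA. Qed.

Lemma normal_part_sum {I J : finType} (c : I -> J -> R)
    (Z : I -> J -> 'rV[R]_m) :
  \sum_i \sum_j c i j *: normal_part G F x (Z i j) =
  normal_part G F x (\sum_i \sum_j c i j *: Z i j).
Proof.
rewrite /normal_part !mulmx_suml -sumrB; apply: eq_bigr => i _.
rewrite !mulmx_suml -sumrB; apply: eq_bigr => j _.
by rewrite -!scalemxAl scalerBr.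
Qed.

(** The kernel of the projection onto the normal space is the tangent space,
    which is the row space of the Jacobian. *)
Lemma normal_part_eq0 Z : Defs.induced G F x \in unitmx ->
  normal_part G F x Z = 0 <-> exists z, Z = z *m jacobian F x.
Proof.
move=> uI; split=> [/eqP|[z ->]].
  by rewrite subr_eq0 => /eqP ->; eexists.
rewrite /normal_part; set J := jacobian F x.
have -> : z *m J *m G (F x) *m J^T = z *m Defs.induced G F x by rewrite !mulmxA.
by rewrite mulmxK // subrr.
Qed.

End NormalPart.

Section ProductMetric.
Context {R : realType} {n : nat}.
Variables (G : 'rV[R]_n -> 'M[R]_n) (eps : R) (y : 'rV[R]_(n + 1)).
Hypotheses (eps_neq0 : eps != 0) (G_unit : G (lsubmx y) \in unitmx).

Definition product_metric (y : 'rV[R]_(n + 1)) : 'M[R]_(n + 1) :=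
  block_mx (G (lsubmx y)) 0 0 eps%:M.

(** For any [g], the two difference quotients are the same function. *)
Lemma derive_comp_lsubmx (g : 'rV[R]_n -> R) e :
  'D_e (fun y : 'rV[R]_(n + 1) => g (lsubmx y)) y = 'D_(lsubmx e) g (lsubmx y).
Proof.
rewrite /derive; congr (lim (_ @ 0^')); apply/funext => t /=.
have -> // : lsubmx (t *: e + y) = t *: lsubmx e + lsubmx y.
by apply/rowP => i; rewrite !mxE.
Qed.

Lemma lsubmx_basis_l i :
  lsubmx (basis_vec (lshift 1 i)) = basis_vec i :> 'rV[R]_n.
Proof.
apply/rowP => j; rewrite !mxE; congr (_ && _)%:R.
Qed.

Lemma lsubmx_basis_r i :
  lsubmx (basis_vec (rshift n i) : 'rV_(n + 1)) = 0 :> 'rV[R]_n.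
Proof. by apply/rowP => j; rewrite !mxE eq_lrshift andbF. Qed.

Lemma invmx_product_metric :
  invmx (product_metric y) = block_mx (invmx (G (lsubmx y))) 0 0 (eps^-1)%:M.
Proof.
rewrite /product_metric invmx_block_diag ?invmx_scalar //.
rewrite unitmxE det_ublock det_scalar1 unitrM -unitmxE G_unit.
by rewrite unitfE.
Qed.

Let derive_metric_ll e j l :
  'D_e (fun y => product_metric y (lshift 1 j) (lshift 1 l)) y =
  'D_(lsubmx e) (fun x => G x j l) (lsubmx y).
Proof.
under eq_fun do rewrite block_mxEul.
exact: (derive_comp_lsubmx (fun x => G x j l)).
Qed.

Let derive_metric_r e (j : 'I_1) k :
  'D_e (fun y => product_metric y (rshift n j) k) y = 0.
Proof.
rewrite -[k]splitK; case: (fintype.split k) => l /=.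
  under eq_fun do rewrite block_mxEdl mxE; exact: derive_cst.
under eq_fun do rewrite block_mxEdr; exact: derive_cst.
Qed.

Let derive_metric_lr e j (l : 'I_1) :
  'D_e (fun y => product_metric y (lshift 1 j) (rshift n l)) y = 0.
Proof. under eq_fun do rewrite block_mxEur mxE; exact: derive_cst. Qed.

Let derive_basis_r (g : 'rV[R]_n -> R) i :
  'D_(lsubmx (basis_vec (rshift n i) : 'rV_(n + 1))) g (lsubmx y) = 0.
Proof. by rewrite lsubmx_basis_r derive0. Qed.

Lemma christoffel_product_l i j k :
  christoffel product_metric y (lshift 1 i) (lshift 1 j) (lshift 1 k) =
  christoffel G (lsubmx y) i j k.
Proof.
rewrite /christoffel invmx_product_metric big_split_ord /=; congr (_ * _).
rewrite [X in _ + X]big1 ?addr0; last first.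
  by move=> l _; rewrite block_mxEur mxE mul0r.
apply: eq_bigr => l _; rewrite block_mxEul.
by rewrite !derive_metric_ll !lsubmx_basis_l.
Qed.

Lemma christoffel_product_r i j (k : 'I_1) :
  christoffel product_metric y i j (rshift n k) = 0.
Proof.
rewrite /christoffel invmx_product_metric big1 ?mulr0 // => l _.
rewrite -[l]splitK; case: (fintype.split l) => {}l /=.
  by rewrite block_mxEdl mxE mul0r.
rewrite -[i]splitK -[j]splitK.
case: (fintype.split i) => {}i; case: (fintype.split j) => {}j /=;
by rewrite ?derive_metric_r ?derive_metric_lr ?derive_metric_ll ?derive_basis_r
  ?(addr0, subr0, mulr0).
Qed.

Lemma christoffel_product_rl i (j : 'I_(n + 1)) k :
  christoffel product_metric y (rshift n i) j (lshift 1 k) = 0.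
Proof.
rewrite /christoffel invmx_product_metric big1 ?mulr0 // => l _.
rewrite -[l]splitK; case: (fintype.split l) => {}l /=; last first.
  by rewrite block_mxEur mxE mul0r.
rewrite -[j]splitK; case: (fintype.split j) => {}j /=;
by rewrite ?derive_metric_r ?derive_metric_lr ?derive_metric_ll ?derive_basis_r
  ?(addr0, subr0, mulr0).
Qed.

Lemma christoffel_product_lr (i : 'I_(n + 1)) j k :
  christoffel product_metric y i (rshift n j) (lshift 1 k) = 0.
Proof.
rewrite /christoffel invmx_product_metric big1 ?mulr0 // => l _.
rewrite -[l]splitK; case: (fintype.split l) => {}l /=; last first.
  by rewrite block_mxEur mxE mul0r.
rewrite -[i]splitK; case: (fintype.split i) => {}i /=;
by rewrite ?derive_metric_r ?derive_metric_lr ?derive_metric_ll ?derive_basis_r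
  ?(addr0, subr0, mulr0).
Qed.

(** The factor [R] is flat and the product metric does not depend on it, so
    only the first components contribute. *)
Lemma chr_product v w :
  chr product_metric y v w = row_mx (chr G (lsubmx y) (lsubmx v) (lsubmx w)) 0.
Proof.
apply/rowP => k; rewrite mxE -[k]splitK.
case: (fintype.split k) => {}k /=; last first.
  rewrite row_mxEr mxE big1 // => i _; rewrite big1 // => j _.
  by rewrite christoffel_product_r !mul0r.
rewrite row_mxEl mxE big_split_ord /= [X in _ + X]big1 ?addr0; last first.
  by move=> i _; rewrite big1 // => j _; rewrite christoffel_product_rl !mul0r.
apply: eq_bigr => i _.
rewrite big_split_ord /= [X in _ + X]big1 ?addr0; last first.
  by move=> j _; rewrite christoffel_product_lr !mul0r.
by apply: eq_bigr => j _; rewrite christoffel_product_l !mxE.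
Qed.

End ProductMetric.

Section Graph.
Context {R : realType} {n : nat}.
Variables (G : 'rV[R]_n -> 'M[R]_n) (eps : R) (v : 'rV[R]_n -> R).
Variables (F : 'rV[R]_n -> 'rV[R]_(n + 1)) (x : 'rV[R]_n).
Hypotheses (eps_neq0 : eps != 0) (G_unit : G x \in unitmx)
  (v_diff : twice_differentiable v x)
  (F_graph : \forall y \near x, F y = row_mx y (const_mx (v y))).
Let a := partials v x.
Let G' := product_metric G eps.

Let F_x : F x = row_mx x (const_mx (v x)).
Proof. exact: nbhs_singleton F_graph. Qed.

Let graph_differentiable :
  differentiable (fun y => row_mx y (const_mx (v y)) : 'rV[R]_(n + 1)) x.
Proof.
apply: differentiable_mx => i j; rewrite -[j]splitK.
case: (fintype.split j) => {}j /=.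
  under eq_fun do rewrite row_mxEl; exact: differentiable_coord.
under eq_fun do rewrite row_mxEr mxE; exact: nbhs_singleton v_diff.1.
Qed.

Let derive_row_mx (b : 'rV[R]_n -> 'rV[R]_n) (c : 'rV[R]_n -> R) y w :
  derivable b y w -> derivable c y w ->
  'D_w (fun y => row_mx (b y) (const_mx (c y)) : 'rV[R]_(n + 1)) y =
  row_mx ('D_w b y) (const_mx ('D_w c y)).
Proof.
move=> db dc; rewrite derive_mx; last first.
  apply/derivable_mxP => i j; rewrite -[j]splitK.
  case: (fintype.split j) => {}j /=.
    under eq_fun do rewrite row_mxEl; exact: (derivable_mxP _ _ _).1 db _ _.
  by under eq_fun do rewrite row_mxEr mxE.
apply/rowP => j; rewrite mxE -[j]splitK (derive_mx db).
case: (fintype.split j) => {}j /=.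
  by under eq_fun do rewrite row_mxEl; rewrite row_mxEl mxE.
by under eq_fun do rewrite row_mxEr mxE; rewrite row_mxEr mxE.
Qed.

Lemma derive_graph w :
  \forall y \near x, 'D_w F y = row_mx w (const_mx ('D_w v y)).
Proof.
have := near_join F_graph; apply: filterS2 v_diff.1 => y dy Fy.
rewrite (near_eq_derive _ Fy) derive_row_mx ?derive_id //.
exact: diff_derivable.
Qed.

Lemma derive2_graph z w :
  'D_z ('D_w F) x = row_mx 0 (const_mx ('D_z ('D_w v) x)).
Proof.
rewrite (near_eq_derive _ (derive_graph w)) derive_row_mx ?derive_cst //.
by apply: diff_derivable; exact: v_diff.2.
Qed.

Lemma jacobian_graph : jacobian F x = row_mx 1%:M a^T.
Proof.
have dF : is_diff x F
    ('d (fun y => row_mx y (const_mx (v y)) : 'rV[R]_(n + 1)) x).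
  apply: near_eq_is_diff graph_differentiable.
  by apply: filterS F_graph => y ->.
apply/row_matrixP => i; rewrite rowE -deriveEjacobian //.
rewrite (nbhs_singleton (derive_graph _)) row_row_mx rowE mulmx1.
by congr row_mx; apply/rowP => k; rewrite !mxE.
Qed.

Lemma induced_graph : Defs.induced G' F x = G x + eps *: (a^T *m a).
Proof.
rewrite /Defs.induced jacobian_graph tr_row_mx trmx1 trmxK F_x /G'.
rewrite /product_metric row_mxKl mul_row_block mul_row_col.
rewrite !mul1mx !mulmx0 !mulmx1 addr0 add0r.
by rewrite mul_mx_scalar -scalemxAl.
Qed.

Lemma covd_graph z w : covd G' F ('D_w F) z x =
  row_mx (chr G x z w) (const_mx ('D_z ('D_w v) x)).
Proof.
rewrite /covd -/(chr G' (F x) ('D_z F x) ('D_w F x)) derive2_graph.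
rewrite !(nbhs_singleton (derive_graph _)) F_x chr_product ?row_mxKl //.
by rewrite add_row_mx add0r addr0.
Qed.

(** Both sides are normal parts, so they agree exactly when the difference of
    the two projected vectors is tangent, that is, of the form [(z, dv z)].
    Its first component [z] is a trace of Christoffel terms and its last one is
    a trace of second derivatives minus 1; subtracting [dv z] turns second
    derivatives into the Hessian. *)
Lemma graph_soliton : Defs.induced G' F x \in unitmx ->
  mean_curvature G' F x = normal_part G' F x (row_mx 0 1) <->
  \tr (invmx (Defs.induced G' F x) *m (hessian G v x)^T) = 1.
Proof.
move=> uI; rewrite /mean_curvature /second_form normal_part_sum.
set B := invmx _; set T := \sum_i _.
pose T1 := \sum_i \sum_j B i j *: chr G x (basis_vec i) (basis_vec j).
pose t2 := \sum_i \sum_j B i j * 'D_(basis_vec i) ('D_(basis_vec j) v) x.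
have TE : T = row_mx T1 (const_mx t2).
  rewrite /T /T1 /t2.
  apply/rowP => k; rewrite -[k]splitK.
  case: (fintype.split k) => {}k /=; rewrite (row_mxEl, row_mxEr).
    rewrite !summxE; apply: eq_bigr => i _; rewrite !summxE.
    by apply: eq_bigr => j _; rewrite covd_graph [LHS]mxE row_mxEl [RHS]mxE.
  rewrite summxE [RHS]mxE; apply: eq_bigr => i _; rewrite summxE.
  by apply: eq_bigr => j _; rewrite covd_graph [LHS]mxE row_mxEr mxE.
(* Contracting [T1] with the differential of [v] gives the Christoffel part of
   the Hessian. *)
have trE : \tr (B *m (hessian G v x)^T) = t2 - (T1 *m a^T) 0 0.
  rewrite /t2 mulmx_suml summxE -sumrB; apply: eq_bigr => i _.
  rewrite mulmx_suml summxE -sumrB mxE; apply: eq_bigr => j _.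
  rewrite -scalemxAl !mxE -mulrBr; congr (_ * (_ - _)).
  apply: eq_bigr => k _; rewrite !mxE; congr (_ * _).
  rewrite (bigD1 i) //= (bigD1 j) //= !mxE !eqxx !mulr1.
  rewrite !big1 ?addr0 // => [i' ne|j' ne].
    by rewrite big1 // => j' _; rewrite !mxE (negbTE ne) mulr0 mul0r.
  by rewrite !mxE (negbTE ne) mulr0.
transitivity (normal_part G' F x (T - row_mx 0 1) = 0).
  rewrite normal_partB.
  by split=> [->|/eqP]; rewrite ?subrr // subr_eq0 => /eqP.
rewrite normal_part_eq0 // jacobian_graph TE opp_row_mx add_row_mx subr0 trE.
split=> [[z]|Et].
  rewrite mul_mx_row mulmx1 => /eq_row_mx[-> /matrixP/(_ 0 0)].
  by rewrite !mxE => <-; rewrite subKr.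
exists T1; rewrite mul_mx_row mulmx1; congr row_mx.
rewrite [RHS]mx11_scalar; apply/matrixP => i j; rewrite !ord1 [RHS]mxE eqxx.
by rewrite mulr1n !mxE -Et opprB addrC subrK; rewrite !mxE.
Qed.

End Graph.

(** * Functions of a submersion: regularity and derivatives *)

Section Reparametrization.
Context {R : realType}.
Implicit Types (psi a f : R -> R) (t : R).

Lemma derivable_continuous f t : derivable f t 1 -> {for t, continuous f}.
Proof. by move=> /derivable1_diffP; exact: differentiable_continuous. Qed.

Lemma derivable_div (a b : R -> R) t : derivable a t 1 -> derivable b t 1 ->
  b t != 0 -> derivable (fun s => a s / b s) t 1.
Proof. move=> da db bt; exact: (derivableM da (derivableV bt db)). Qed.

(** A nonvanishing derivative makes the function injective on a ball, by the
    mean value theorem. *)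
Lemma local_left_inverse psi t0 :
  (\forall t \near t0, derivable psi t 1 /\ 'D_1 psi t != 0) ->
  exists g, {near t0, cancel psi g}.
Proof.
move=> /nbhs_ballP[r /= r0 dpsi].
have inj s t : ball t0 r s -> ball t0 r t -> s < t -> psi s != psi t.
  move=> bs bt st.
  have in_ball z : z \in `[s, t] -> ball t0 r z.
    move: bs bt; rewrite /ball /= !ltr_distlC => /andP[s1 s2] /andP[t1 t2].
    rewrite in_itv /= => /andP[sz zt].
    by rewrite (lt_le_trans s1 sz) (le_lt_trans zt t2).
  have [|| c cst E] := @MVT R psi ('D_1 psi) s t st.
  - move=> z zst; apply: derivableP; apply: (dpsi _ _).1.
    by apply: in_ball; exact: subset_itv_oo_cc zst.
  - apply: derivable_within_continuous => z zst.
    by apply: (dpsi _ _).1; exact: in_ball.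
  have dc : 'D_1 psi c != 0.
    by apply: (dpsi _ _).2; apply: in_ball; exact: subset_itv_oo_cc cst.
  by rewrite eq_sym -subr_eq0 E mulf_neq0 // subr_eq0 gt_eqF.
exists (fun y => xget t0 [set t | ball t0 r t /\ psi t = y]).
apply/nbhs_ballP; exists r => // t /= bt.
case: xgetP => [s _ [bs Est]|/(_ t)]; last by case.
by apply/eqP; case: ltgtP => // /inj; [move=> /(_ bs bt)|move=> /(_ bt bs)];
  rewrite Est eqxx.
Qed.

(** Near [psi t0], the function [f] is the composite of [a] with the inverse of
    [psi]. *)
Lemma derive_reparametrized psi a f t0 :
  (\forall t \near t0, derivable psi t 1 /\ 'D_1 psi t != 0) ->
  derivable a t0 1 -> (\forall t \near t0, f (psi t) = a t) ->
  is_derive (psi t0) 1 f ('D_1 a t0 / 'D_1 psi t0).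
Proof.
move=> dpsi da fpsi.
have [g gK] := local_left_inverse _ _ dpsi.
have [dpsi0 psi0] := nbhs_singleton dpsi.
have psi_cont : {near t0, continuous psi}.
  apply: filterS dpsi => t [dt _].
  exact: derivable_continuous.
have dg : is_derive (psi t0) 1 g ('D_1 psi t0)^-1.
  by apply: is_derive_inverse => //; exact: derivableP.
have Kg := near_continuous_can_sym psi_cont gK.
have g_cont : {for psi t0, continuous g}.
  by case: dg => dg _; exact: (derivable_continuous _ _ dg).
have g0 : g (psi t0) = t0 := nbhs_singleton gK.
apply: (@near_eq_is_derive _ _ _ (a \o g)).
  have fg : \forall y \near psi t0, f (psi (g y)) = a (g y).
    have : nbhs (g (psi t0)) [set t | f (psi t) = a t] by rewrite g0.
    exact: g_cont.
  by apply: filterS2 fg Kg => y /= <- ->.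
have da' : is_derive (g (psi t0)) 1 a ('D_1 a t0).
  by rewrite g0; exact: derivableP da.
exact: is_derive1_comp da' dg.
Qed.

(** The derivative of [f] satisfies a relation of the same kind,
    [f' (psi t) = a' t / psi' t], so the first order result applies twice. *)
Lemma twice_derivable_reparametrized psi a f t0 :
  (\forall t \near t0, derivable psi t 1) ->
  (\forall t \near t0, derivable a t 1) ->
  derivable ('D_1 psi) t0 1 -> derivable ('D_1 a) t0 1 -> 'D_1 psi t0 != 0 ->
  (\forall t \near t0, f (psi t) = a t) ->
  derivable f (psi t0) 1 /\ derivable (derive1 f) (psi t0) 1.
Proof.
move=> dpsi da d2psi d2a psi0 fpsi.
have psi1 : \forall t \near t0, 'D_1 psi t != 0.
  have cpsi : {for t0, continuous ('D_1 psi)}.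
    exact: (derivable_continuous _ _ d2psi).
  exact: (cvgr_neq0 _ cpsi).
have dpsi1 : \forall t \near t0, derivable psi t 1 /\ 'D_1 psi t != 0.
  by apply: filterS2 dpsi psi1.
split.
  have da0 := nbhs_singleton da.
  by have [] := derive_reparametrized _ _ _ _ dpsi1 da0 fpsi.
have f1 : \forall t \near t0, derive1 f (psi t) = 'D_1 a t / 'D_1 psi t.
  have := near_join dpsi1; have := near_join fpsi; move: da.
  apply: filterS3 => t dat ft dpt.
  by rewrite derive1E; apply: derive_val; exact: derive_reparametrized.
have dq := derivable_div _ _ _ d2a d2psi psi0.
by have [] := derive_reparametrized _ _ _ _ dpsi1 dq f1.
Qed.

End Reparametrization.

Section Composition.
Context {R : realType} {n : nat}.
Implicit Types (phi v : 'rV[R]_n -> R) (x w : 'rV[R]_n) (f : R -> R).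

Lemma is_diff_line x w (t : R) :
  is_diff t (fun s : R => x + s *: w) (fun s => s *: w).
Proof.
have -> : (fun s : R => s *: w) = 0 + (fun s => s *: w).
  by apply/funext => s; rewrite fctE add0r.
exact: is_diffD.
Qed.

Lemma derive_line phi x w t : differentiable phi (x + t *: w) ->
  derivable (fun s : R => phi (x + s *: w)) t 1 /\
  'D_1 (fun s : R => phi (x + s *: w)) t = 'D_w phi (x + t *: w).
Proof.
move=> dphi; have dl := is_diff_line x w t.
have dc : differentiable (phi \o (fun s : R => x + s *: w)) t.
  exact: differentiable_comp.
split; first exact: diff_derivable.
rewrite deriveE // (@diff_comp _ _ _ _ (fun s : R => x + s *: w)) //=.
have -> : 'd (fun s : R => x + s *: w) t 1 = w.
  by case: dl => _ /(congr1 (@^~ 1)) ->; rewrite scale1r.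
by rewrite deriveE.
Qed.

(** Along a line transverse to the level sets of [phi], the function [f] is
    read off [v] through a one-variable change of parameter, whence its
    regularity. *)
Lemma factor_twice_derivable phi v f x w :
  twice_differentiable phi x -> twice_differentiable v x ->
  (\forall y \near x, v y = f (phi y)) -> 'D_w phi x != 0 ->
  derivable f (phi x) 1 /\ derivable (derive1 f) (phi x) 1.
Proof.
move=> [dphi d2phi] [dv d2v] vE phiw.
have line_cvg : (fun s : R => x + s *: w) @ (0 : R) --> x.
  have : {for (0 : R), continuous (fun s : R => x + s *: w)}.
    by apply: differentiable_continuous; case: (is_diff_line x w 0).
  by rewrite /prop_for /continuous_at scale0r addr0.
have along (P : set 'rV[R]_n) : (\forall y \near x, P y) ->
  \forall s \near (0 : R), P (x + s *: w) by exact: line_cvg.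
have x0 : x + 0 *: w = x by rewrite scale0r addr0.
have dline (g : 'rV[R]_n -> R) : twice_differentiable g x ->
    (\forall s \near (0 : R), derivable (fun s : R => g (x + s *: w)) s 1) /\
    derivable ('D_1 (fun s : R => g (x + s *: w))) 0 1.
  move=> [dg d2g].
  split; first by apply: filterS (along _ dg) => s /derive_line[].
  apply: (@near_eq_derivable _ _ _ (fun s : R => 'D_w g (x + s *: w))).
    by apply: filterS (along _ dg) => s /derive_line[].
  by have [] := derive_line ('D_w g) x w 0 _; rewrite x0.
have [p1 p2] := dline phi (conj dphi d2phi).
have [v1 v2] := dline v (conj dv d2v).
have := twice_derivable_reparametrized _ _ f 0 p1 v1 p2 v2; rewrite x0; apply.
  have [|_ ->] := derive_line phi x w 0; rewrite x0 //.
  exact: nbhs_singleton dphi.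
by apply: filterS (along _ vE) => s ->.
Qed.

Section Formulas.
Variables (phi v : 'rV[R]_n -> R) (f : R -> R) (x : 'rV[R]_n).
Hypotheses (phi_diff : twice_differentiable phi x)
  (vE : \forall y \near x, v y = f (phi y))
  (f_diff : \forall y \near x, derivable f (phi y) 1)
  (f1_diff : derivable (derive1 f) (phi x) 1).

Lemma chain_rule (g : R -> R) y w :
  differentiable phi y -> derivable g (phi y) 1 ->
  is_derive y w (g \o phi) (derive1 g (phi y) * 'D_w phi y).
Proof.
move=> dphi dg; have /derivable1_diffP dg' := dg.
have dc : differentiable (g \o phi) y by exact: differentiable_comp.
apply: DeriveDef; first exact: diff_derivable.
rewrite deriveE // diff_comp //= deriv1E // deriveE // /GRing.scale /=.
by rewrite mulrC.
Qed.

Lemma derive_factor w :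
  \forall y \near x, 'D_w v y = derive1 f (phi y) * 'D_w phi y.
Proof.
have := near_join vE; move: phi_diff.1 f_diff; apply: filterS3 => y dphi df Ey.
by rewrite (near_eq_derive _ Ey); apply: derive_val; exact: chain_rule.
Qed.

Lemma partials_factor : partials v x = derive1 f (phi x) *: partials phi x.
Proof. by apply/rowP => i; rewrite !mxE (nbhs_singleton (derive_factor _)). Qed.

Lemma derive2_factor z w : 'D_z ('D_w v) x =
  derive1 (derive1 f) (phi x) * 'D_z phi x * 'D_w phi x +
  derive1 f (phi x) * 'D_z ('D_w phi) x.
Proof.
have dphi := nbhs_singleton phi_diff.1.
have c1 := chain_rule (derive1 f) x z dphi f1_diff.
rewrite (near_eq_derive _ (derive_factor w)) (@deriveM _ _ (derive1 f \o phi)).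
- by rewrite derive_val /GRing.scale /= addrC mulrC.
- exact: ex_derive.
- exact: diff_derivable (phi_diff.2 w).
Qed.

Lemma hessian_factor (G : 'rV[R]_n -> 'M[R]_n) : hessian G v x =
  derive1 (derive1 f) (phi x) *: ((partials phi x)^T *m partials phi x) +
  derive1 f (phi x) *: hessian G phi x.
Proof.
apply/matrixP => i j; rewrite !mxE derive2_factor partials_factor.
rewrite big_ord1 !mxE mulrBr mulrA -addrA; congr (_ + (_ - _)).
by rewrite mulr_sumr; apply: eq_bigr => k _; rewrite mxE mulrCA.
Qed.

End Formulas.
End Composition.

(** * Gradient of a semi-Riemannian submersion *)

Lemma Ck2_twice_differentiable {R : realType} {n : nat} (U : set 'rV[R]_n)
    (phi : 'rV[R]_n -> R) x :
  open U -> U x -> Ck 2 U phi -> twice_differentiable phi x.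
Proof.
move=> oU Ux [dphi d2phi]; split; last by move=> w; exact: (d2phi w).1.
by apply: filterS (open_nbhs_nbhs (conj oU Ux)) => y /dphi.
Qed.

Section Charts.
Context {R : realType} {n : nat}.
Variable M : charted R n.
Hypothesis hM : smooth_manifold M.
Implicit Types c d : atlas M.

Lemma near_cim c x : cim c x -> \forall y \near x, cim c y.
Proof.
by move=> cx; exact: open_nbhs_nbhs (conj (@sm_open_im _ _ _ hM c) cx).
Qed.

Lemma param_cim c x :
  cim c x -> cdom c (param c x) /\ Defs.coord c (param c x) = x.
Proof. by case=> p cp <-; rewrite (sm_coordK hM cp). Qed.

Lemma cim_pt (p : M) : cim (chart_at p) (pt p).
Proof. by exists p; [exact: (sm_chart_at hM)|]. Qed.

Lemma param_pt (p : M) : param (chart_at p) (pt p) = p.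
Proof. exact: (sm_coordK hM (sm_chart_at hM p)). Qed.

(** Stated for the values of a function on the manifold: [transition c d] is
    only meaningful at the points whose image by [param c] is in the domain of
    [d]. *)
Lemma near_transition c d x (phi : M -> R) : overlap c d x ->
  \forall y \near x, phi (param c y) = phi (param d (transition c d y)).
Proof.
case=> p [cp dp] px; have cx : cim c x by exists p.
have cont := sm_param_cont hM cx.
have : nbhs (param c x) (cdom d).
  apply: open_nbhs_nbhs; split; first exact: (@sm_open_dom _ _ _ hM d).
  by rewrite -px (sm_coordK hM cp).
move=> Nd; have : nbhs x (param c @^-1` cdom d) by exact: cont.
apply: filterS => y dy.
by rewrite /transition /= (sm_coordK hM dy).
Qed.

End Charts.

Section GradientNorm.
Context {R : realType} {n : nat}.

Lemma ip_gradient (G : 'rV[R]_n -> 'M[R]_n) phi x w :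
  G x \in unitmx -> (G x)^T = G x -> differentiable phi x ->
  ip (G x) (gradient G phi x) w = 'D_w phi x.
Proof.
move=> uG sG dphi; rewrite /ip gradient_metric // mxE derive_partials //.
by apply: eq_bigr => i _; rewrite [w^T _ _]mxE mulrC.
Qed.

(** The length of the gradient does not depend on the chart: if [J] is the
    matrix of the change of chart, the row vectors of components of the gradient
    satisfy [N J = N']. *)
Lemma ip_gradient_change (G G' : 'rV[R]_n -> 'M[R]_n) (phi psi : 'rV[R]_n -> R)
    (T : 'rV[R]_n -> 'rV[R]_n) x :
  differentiable T x -> differentiable psi (T x) ->
  (\forall y \near x, phi y = psi (T y)) ->
  G x = jacobian T x *m G' (T x) *m (jacobian T x)^T -> G x \in unitmx ->
  ip (G x) (gradient G phi x) (gradient G phi x) =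
  ip (G' (T x)) (gradient G' psi (T x)) (gradient G' psi (T x)).
Proof.
move=> dT dpsi phiE; set J := jacobian T x => GE uG.
have := uG; rewrite {1}GE !unitmx_mul unitmx_tr => /andP[/andP[uJ uG'] _].
have aE : partials phi x = partials psi (T x) *m J^T.
  apply/rowP => i; rewrite mxE (near_eq_derive _ phiE).
  rewrite (deriveE _ (differentiable_comp dT dpsi)) diff_comp //=.
  rewrite -(deriveE _ dpsi) derive_partials // mxE; apply: eq_bigr => k _.
  rewrite mulrC [(J^T) _ _]mxE; congr (_ * _).
  by rewrite -(deriveE _ dT) deriveEjacobian // -rowE mxE.
have NJ : gradient G phi x *m J = gradient G' psi (T x).
  have uJT : J^T \in unitmx by rewrite unitmx_tr.
  apply: (can_inj (mulmxK uG')); apply: (can_inj (mulmxK uJT)).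
  by rewrite gradient_metric // -aE -(gradient_metric G) // GE !mulmxA.
by rewrite -NJ /ip GE (trmx_mul (gradient G phi x) J) !mulmxA.
Qed.

End GradientNorm.

Section Submersion.
Context {R : realType} {n : nat}.
Variables (M : semiRiem R n) (I : set R) (teps : R) (pi : M -> R).
Hypotheses (hM : semi_riemannian_manifold M)
  (hpi : semi_riemannian_submersion I teps pi) (hteps : teps = 1 \/ teps = -1).
Implicit Type p : M.

Let hM' := sr_smooth_manifold hM.
Let grad p := gradient (local_metric p) (local_fun pi p) (pt p).

Lemma sign_sqr (e : R) : e = 1 \/ e = -1 -> e * e = 1.
Proof. by case=> ->; rewrite ?mulrNN mulr1. Qed.

Lemma chart_twice_differentiable (u : M -> R) (c : atlas M) x :
  Ck_fun 2 u -> cim c x -> twice_differentiable (u \o param c) x.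
Proof.
move=> hu cx.
exact: Ck2_twice_differentiable (@sm_open_im _ _ _ hM' c) cx (hu c).
Qed.

Lemma chart_metric_unit (c : atlas M) x :
  cim c x -> \forall y \near x, metric c y \in unitmx.
Proof. by move=> /(near_cim _ hM'); apply: filterS => y; exact: sr_nondeg. Qed.

Lemma chart_metric_sym (c : atlas M) x :
  cim c x -> \forall y \near x, (metric c y)^T = metric c y.
Proof. by move=> /(near_cim _ hM'); apply: filterS => y; exact: sr_sym. Qed.

Lemma chart_metric_differentiable (c : atlas M) x :
  cim c x -> differentiable (metric c) x.
Proof. by move=> cx; exact: (sr_smooth hM c 1%N).1. Qed.

Let pi_diff p : twice_differentiable (local_fun pi p) (pt p).
Proof.
by apply: chart_twice_differentiable (sub_smooth hpi 2) _; exact: cim_pt.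
Qed.

Let dpi p : differentiable (local_fun pi p) (pt p) :=
  nbhs_singleton (pi_diff p).1.

Lemma dfunE p w : dfun pi p w = 'D_w (local_fun pi p) (pt p).
Proof. by rewrite deriveE. Qed.

Lemma inner_grad p w : inner p (grad p) w = dfun pi p w.
Proof.
have cp := cim_pt _ hM' p.
by rewrite dfunE -(ip_gradient (local_metric p)) //;
  [exact: sr_nondeg|exact: sr_sym].
Qed.

(** The gradient is horizontal, so the isometry condition makes [dpi grad]
    equal to its own square up to the sign; it cannot vanish, since a gradient
    tangent to the fiber would be orthogonal to the whole fiber. *)
Lemma inner_grad_grad p : inner p (grad p) (grad p) = teps.
Proof.
have tt := sign_sqr _ hteps.
have hor : horizontal pi p (grad p) by move=> w; rewrite inner_grad.
have := sub_isometry hpi hor hor.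
rewrite inner_grad; set q := dfun _ _ _ => E.
have q0 : q != 0.
  apply/eqP => q0.
  have g0 : grad p = 0.
    by apply: (sub_fiber_nondeg hpi q0) => w; rewrite inner_grad.
  have [w] := sub_submersion hpi p 1; rewrite -inner_grad g0 /inner /ip !mul0mx.
  by rewrite mxE => /eqP; rewrite eq_sym oner_eq0.
have : teps * q = 1 by apply: (mulIf q0); rewrite mul1r.
by move=> tq; rewrite -[RHS]mulr1 -tq mulrA tt mul1r.
Qed.

(** The submersion condition is stated in the distinguished chart at each point;
    a fixed chart [c] is compared, at each of its points, with the distinguished
    chart there. *)
Lemma chart_gradient_norm (c : atlas M) x : cim c x ->
  ip (metric c x) (gradient (metric c) (pi \o param c) x)
    (gradient (metric c) (pi \o param c) x) = teps.
Proof.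
move=> cx; have [cq qx] := param_cim _ hM' _ _ cx.
set q := param c x in cq qx; set d := chart_at q.
have ov : overlap c d x by exists q => //; split=> //; exact: sm_chart_at.
have Tx : transition c d x = pt q by [].
rewrite (ip_gradient_change (metric c) (metric d) _ (pi \o param d)
  (transition c d)).
- by rewrite Tx; exact: inner_grad_grad.
- exact: (sm_transition hM' c d 1%N).1.
- by rewrite Tx; exact: dpi.
- exact: near_transition hM' _ _ _ pi ov.
- exact: (sr_transition hM ov).
- exact: sr_nondeg.
Qed.

Let H p := hessian (local_metric p) (local_fun pi p) (pt p).

(** The length of the gradient is constant not only at [pt p] but in the whole
    chart, so it can be differentiated. *)
Lemma hessian_grad p v : ip (H p) v (grad p) = 0.
Proof.
have cp := cim_pt _ hM' p.
rewrite ip_hessian_gradient.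
- rewrite (@near_eq_derive _ _ _ _ (cst teps)) ?derive_cst ?mulr0 //.
  by apply: filterS (near_cim _ hM' _ _ cp) => y; exact: chart_gradient_norm.
- exact: chart_metric_differentiable.
- exact: chart_metric_unit.
- exact: chart_metric_sym.
- exact: pi_diff.
Qed.

Lemma nabla_gradE p v w : inner p (nabla_grad pi p v) w = ip (H p) v w.
Proof.
have cp := cim_pt _ hM' p.
apply: ip_covd_gradient.
- exact: chart_metric_differentiable.
- exact: chart_metric_unit.
- exact: chart_metric_sym.
- exact: pi_diff.
Qed.

End Submersion.

(** * Translating solitons *)

(** With [N] the unit normal, the trace over the tangent directions [E] is the
    full trace as soon as [H (N, N) = 0]. *)
Lemma trace_orthonormal_frame {R : realType} {n : nat} (G H : 'M[R]_n)
    (N : 'rV[R]_n) (E : 'M[R]_(n.-1, n)) (s : 'rV[R]_n.-1) (e : R) :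
  (forall i, s 0 i * s 0 i = 1) -> e * e = 1 -> G^T = G ->
  E *m G *m E^T = diag_mx s -> (forall i, ip G N (row i E) = 0) ->
  ip G N N = e -> ip H N N = 0 ->
  \tr (invmx G *m H^T) = \sum_i s 0 i * ip H (row i E) (row i E).
Proof.
(* For [n = 0] the length [e] of [N] would vanish. *)
case: n G H N E s => [|n] G H N E s hs he symG hE hNE hN HN.
  move: he; rewrite -hN /ip (thinmx0 N) !mul0mx mxE mul0r.
  by move/eqP; rewrite eq_sym oner_eq0.
have NGE : N *m G *m E^T = 0.
  apply/rowP => i; have := hNE i; rewrite /ip tr_row => Ei.
  rewrite [RHS]mxE -{}Ei [LHS]mxE [RHS]mxE.
  by apply: eq_bigr => k _; rewrite [RHS]mulrC [in RHS]mxE mulrC.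
have EGN : E *m G *m N^T = 0.
  by apply: trmx_inj; rewrite !trmx_mul trmxK symG trmx0 mulmxA.
have NGN : N *m G *m N^T = e%:M by rewrite ip_mx hN.
rewrite (@orthonormal_frame_invmx _ n G E N s e hs he hE EGN NGE NGN).
rewrite mulmxDl linearD /= -scalemxAl linearZ /=.
have -> : \tr (N^T *m N *m H^T) = 0.
  rewrite -mulmxA mxtrace_mulC -[LHS]mxtrace_tr !trmx_mul !trmxK mulmxA.
  by rewrite ip_mx HN mxtrace_scalar.
rewrite mulr0 addr0 -!mulmxA mxtrace_mulC -!mulmxA.
rewrite mul_diag_mx; apply: eq_bigr => i _; rewrite mxE; congr (_ * _).
have -> : E *m (H^T *m E^T) = (E *m H *m E^T)^T.
  by rewrite !trmx_mul trmxK.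
by rewrite /ip -row_mul [LHS]mxE [LHS]mxE [RHS]mxE; apply: eq_bigr => k _;
   rewrite !mxE.
Qed.

(** Multiply by [e (1 + k e) = e + k], the square length of the normal to the
    graph up to a sign. *)
Lemma soliton_scalar {F : fieldType} (e k f1 f2 m : F) :
  e * e = 1 -> 1 + k * e != 0 ->
  f2 * (e / (1 + k * e)) + f1 * m = 1 <-> f2 = (e + k) * (1 - f1 * m).
Proof.
move=> ee d0.
have -> : e + k = e * (1 + k * e) by rewrite mulrDr mulr1 mulrCA ee mulr1.
split=> [/(canRL (addrK _)) <-|->].
  have -> : e * (1 + k * e) * (f2 * (e / (1 + k * e))) = (e * e) * f2 by field.
  by rewrite ee mul1r.
have -> : e * (1 + k * e) * (1 - f1 * m) * (e / (1 + k * e)) =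
  (e * e) * (1 - f1 * m) by field.
by rewrite ee mul1r subrK.
Qed.

Section Main.
Context {R : realType} {n : nat}.
Variables (M : semiRiem R n) (I : set R) (eps teps : R) (pi u : M -> R).
Variables (h f : R -> R).
Hypotheses (heps : eps = 1 \/ eps = -1) (hteps : teps = 1 \/ teps = -1)
  (hM : semi_riemannian_manifold M)
  (hpi : semi_riemannian_submersion I teps pi)
  (hh : represents_fiber_mean_curvature pi h)
  (hu : Ck_fun 2 u) (hF : semi_riemannian_hypersurface (graph_map eps u))
  (hf : forall p, u p = f (pi p)).

Let hM' := sr_smooth_manifold hM.

(** The mean curvature of the fibers is the divergence of the gradient. *)
Lemma trace_hessian p :
  \tr (invmx (local_metric p (pt p)) *m
    (hessian (local_metric p) (local_fun pi p) (pt p))^T) = h (pi p).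
Proof.
have [E [s [[sE vE oE] ->]]] := hh p.
rewrite (trace_orthonormal_frame _ _
  (gradient (local_metric p) (local_fun pi p) (pt p)) E s teps).
- by apply: eq_bigr => i _; rewrite (nabla_gradE M I teps).
- by move=> i; exact: sign_sqr.
- exact: sign_sqr.
- by apply: (sr_sym hM); exact: cim_pt.
- by [].
- by move=> i; rewrite -/(inner _ _ _) (inner_grad _ I teps) // vE.
- exact: (inner_grad_grad _ I).
- exact: (hessian_grad _ I teps).
Qed.

Let local_regular (phi : M -> R) p : Ck_fun 2 phi ->
  twice_differentiable (local_fun phi p) (pt p).
Proof.
by move=> hphi; apply: chart_twice_differentiable => //; exact: cim_pt.
Qed.

(** The regularity of [f] is inherited from [u], as [pi] is a submersion. *)
Lemma profile_regular s : I s -> derivable f s 1 /\ derivable (derive1 f) s 1.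
Proof.
rewrite -(sub_onto hpi) => -[p _ <-].
have [w dw] := sub_submersion hpi p 1.
rewrite -[p](param_pt _ hM').
apply: (@factor_twice_derivable _ _ (local_fun pi p) (local_fun u p) f _ w).
- exact: local_regular (sub_smooth hpi 2).
- exact: local_regular.
- by apply: filterE => y; exact: hf.
- by rewrite -(dfunE _ I teps) // dw oner_neq0.
Qed.

(** The soliton equation is pointwise: at [p] it reads [tr (A^-1 Hess u) = 1],
    with [Hess u = f'' dpi^2 + f' Hess pi] and [A = g + eps f'^2 dpi^2], and the
    trace is [f'' teps / (1 + eps teps f'^2) + f' h]. *)
Lemma soliton_at p :
  mean_curvature_vector (graph_map eps u) p =
    normal_component (graph_map eps u) p (@partial_t R n) <->
  derive1 (derive1 f) (pi p) =
    (teps + eps * derive1 f (pi p) ^+ 2) * (1 - derive1 f (pi p) * h (pi p)).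
Proof.
set G := local_metric p; set x := pt p.
set phi := local_fun pi p; set v := local_fun u p.
have cp : cim (chart_at p) x := cim_pt _ hM' p.
have phix : phi x = pi p by rewrite /phi /local_fun /= (param_pt _ hM').
have I_phi y : I (phi y).
  by rewrite -(sub_onto hpi); exists (param (chart_at p) y).
have phi2 : twice_differentiable phi x := local_regular _ p (sub_smooth hpi 2).
have v2 : twice_differentiable v x := local_regular _ p hu.
have vE : \forall y \near x, v y = f (phi y) by apply: filterE => y; exact: hf.
have uG : G x \in unitmx := sr_nondeg hM cp.
have sG : (G x)^T = G x := sr_sym hM cp.
have fd : \forall y \near x, derivable f (phi y) 1.
  by apply: filterE => y; exact: (profile_regular _ (I_phi y)).1.
have f1d : derivable (derive1 f) (phi x) 1 := (profile_regular _ (I_phi x)).2.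
pose F := local_map (graph_map eps u) p.
have FE : \forall y \near x, F y = row_mx y (const_mx (v y)).
  apply: filterS (near_cim _ hM' _ _ cp) => y cy.
  by rewrite /F /local_map /= (param_cim _ hM' _ _ cy).2.
have eps0 : eps != 0 by case: heps => ->; rewrite ?oppr_eq0 oner_eq0.
have uI : Defs.induced (product_metric G eps) F x \in unitmx := hF p.
have -> : mean_curvature_vector (graph_map eps u) p =
  mean_curvature (product_metric G eps) F x by [].
have -> : normal_component (graph_map eps u) p (@partial_t R n) =
  normal_part (product_metric G eps) F x (row_mx 0 1) by [].
rewrite (graph_soliton G eps v F x eps0 uG v2 FE uI).
have tt := sign_sqr _ hteps.
set a := partials phi x.
have a_norm : a *m invmx (G x) *m a^T = teps%:M.
  rewrite -(inner_grad_grad M I teps pi hM hpi hteps p) /inner -ip_mx.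
  rewrite -/G -/x -/phi (gradient_metric G phi x uG) -/a /gradient -/a.
  rewrite trmx_mul trmx_inv sG.
  by rewrite mulmxA.
set k := eps * _ ^+ 2.
have IE : Defs.induced (product_metric G eps) F x = G x + k *: (a^T *m a).
  rewrite (induced_graph G eps v F x v2 FE).
  rewrite (partials_factor phi v f x phi2 vE fd) phix -/a.
  by rewrite !linearZ /= -scalemxAl !scalerA mulrAC -expr2 [_ * eps]mulrC.
rewrite IE in uI *.
rewrite (hessian_factor phi v f x phi2 vE fd f1d G) phix -/a.
have NHN : a *m invmx (G x) *m hessian G phi x *m (a *m invmx (G x))^T = 0.
  rewrite ip_mx (hessian_grad M I teps pi hM hpi hteps p).
  exact: raddf0.
rewrite (rank_one_update_trace (G x) a teps k uG sG tt a_norm uI _ _ _ _ NHN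
  (trace_hessian p)).
by apply: soliton_scalar => //; exact: (rank_one_update_neq0 (G x) a teps k).
Qed.

End Main.

Theorem theorem2 (R : realType) (n : nat) (I : set R) (eps teps : R)
    (M : semiRiem R n) (pi : M -> R) (h : R -> R) (u : M -> R) (f : R -> R)
    (I_open : open I) (I_interval : is_interval I) (I_nonempty : I !=set0)
    (heps : eps = 1 \/ eps = -1) (hteps : teps = 1 \/ teps = -1)
    (hM : semi_riemannian_manifold M)
    (hpi : semi_riemannian_submersion I teps pi)
    (hh : represents_fiber_mean_curvature pi h)
    (hu : Ck_fun 2 u) (hu_const : constant_along_fibers pi u)
    (hF : semi_riemannian_hypersurface (graph_map eps u))
    (hf : forall p, u p = f (pi p)) :
  translating_soliton (graph_map eps u) <-> soliton_ode I eps teps h f.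
Proof.
have at_p := soliton_at M I eps teps pi u h f heps hteps hM hpi hh hu hF hf.
split=> [sol s Is|ode p]; last first.
  apply/at_p; have Ip : I (pi p) by rewrite -(sub_onto hpi); exists p.
  by have [_ _ ->] := ode _ Ip.
have [df d2f] := profile_regular M I teps pi u f hM hpi hu hf s Is.
split=> //; move: Is; rewrite -(sub_onto hpi) => -[p _ <-].
exact/at_p.
Qed.
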